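(* Let $n\geq 2$ and let $F:\mathbb{R}^{n+1}_1\to\mathbb{R}^{n+1}_1$, $(y_1,\dots,y_{n+1}) = F(x_1,\dots,x_{n+1})$, be a smooth diffeomorphism, where $(x_1,\dots,x_{n+1})$ are the standard coordinates. Then $F$ is a causal automorphism of $\mathbb{R}^{n+1}_1$ if and only if both of the following hold: (i) $\frac{\partial y_{n+1}}{\partial x_{n+1}} \geq 0$ everywhere; (ii) for every smooth function $\varphi$ on $\mathbb{R}^{n+1}$, $$\sum_{i=1}^n \frac{\partial^2 \varphi}{\partial x_i^2} - \frac{\partial^2 \varphi}{\partial x_{n+1}^2} = 0 \ \text{ everywhere} \iff \sum_{i=1}^n \frac{\partial^2 \varphi}{\partial y_i^2} - \frac{\partial^2 \varphi}{\partial y_{n+1}^2} = 0 \ \text{ everywhere},$$ where on the right $\varphi$ is expressed in the $y$-coordinates (i.e. as $\varphi\circ F^{-1}$).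
   Context: $\mathbb{R}^{n+1}_1$ denotes $\mathbb{R}^{n+1}$ with the Minkowski inner product of signature $(+,\dots,+,-)$: $\langle u,v\rangle = \sum_{i=1}^n u_i v_i - u_{n+1}v_{n+1}$. A vector $v\ne 0$ is causal if $\langle v,v\rangle\le 0$, and future-directed if moreover $v_{n+1}>0$. The causal relation is $p \le q$ iff $q-p$ is zero or a future-directed causal vector. A causal automorphism of $\mathbb{R}^{n+1}_1$ is a bijection $F:\mathbb{R}^{n+1}_1\to\mathbb{R}^{n+1}_1$ such that $p\le q \iff F(p)\le F(q)$ for all $p,q$. *)

(* Defs.v *)
From Stdlib Require Import Reals.
From mathcomp Require Import ssreflect ssrbool ssrfun eqtype ssrnat seq fintype bigop.


Open Scope R_scope.

(* A point of R^{n+1}: coordinates indexed by 'I_(n+1); the coordinate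
   x_{n+1} (time) is the index ord_max (value n); x_1..x_n are indices 0..n-1. *)
Definition Pt (n : nat) := 'I_n.+1 -> R.

Definition vsub n (u v : Pt n) : Pt n := fun i => u i - v i.
Definition vzero n : Pt n := fun _ => 0.

Definition mink n (u v : Pt n) : R :=
  \big[Rplus/0]_(i < n.+1 | ltn (nat_of_ord i) n) (u i * v i) - u ord_max * v ord_max.

Definition causal_vec n (v : Pt n) : Prop := v <> @vzero n /\ mink n v v <= 0.
Definition future_causal n (v : Pt n) : Prop := causal_vec n v /\ 0 < v ord_max.

Definition causal_le n (p q : Pt n) : Prop :=
  vsub n q p = @vzero n \/ future_causal n (vsub n q p).

Definition causal_automorphism n (F : Pt n -> Pt n) : Prop :=
  bijective F /\ forall p q, causal_le n p q <-> causal_le n (F p) (F q).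

Definition shift n (x : Pt n) (i : 'I_n.+1) (t : R) : Pt n :=
  fun j => if j == i then x j + t else x j.

Definition is_partial n (f : Pt n -> R) (i : 'I_n.+1) (x : Pt n) (l : R) : Prop :=
  derivable_pt_lim (fun t => f (shift n x i t)) 0 l.

Definition continuous_fun n (f : Pt n -> R) : Prop :=
  forall x eps, 0 < eps -> exists delta, 0 < delta /\
    forall y : Pt n, (forall i, Rabs (y i - x i) < delta) -> Rabs (f y - f x) < eps.

Fixpoint Ck n (k : nat) (f : Pt n -> R) : Prop :=
  match k with
  | O => continuous_fun n f
  | S k' => continuous_fun n f /\
      forall i, exists g : Pt n -> R, (forall x, is_partial n f i x (g x)) /\ Ck n k' g
  end.

Definition smooth n (f : Pt n -> R) : Prop := forall k, Ck n k f.

Definition smooth_map n (F : Pt n -> Pt n) : Prop := forall i, smooth n (fun x => F x i).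

Definition wave_zero n (f : Pt n -> R) : Prop :=
  exists d1 d2 : 'I_n.+1 -> Pt n -> R,
    (forall i x, is_partial n f i x (d1 i x)) /\
    (forall i x, is_partial n (d1 i) i x (d2 i x)) /\
    forall x, \big[Rplus/0]_(i < n.+1 | ltn (nat_of_ord i) n) d2 i x - d2 ord_max x = 0.

(* Main.v *)
(* If F is a causal automorphism, it maps null lines to null lines and null
   hyperplanes to null hyperplanes.  Two null hyperplanes are disjoint only if
   they are parallel, so F maps null lines with a given direction to null lines
   with a direction depending only on the given one.  Hence
   all null vectors are eigenvectors of (DF_p)^-1 DF_q, which is then scalar as
   there are at least two space dimensions; by the symmetry of second
   derivatives the scalar is constant, F is affine, and DF is a similarity of
   the Minkowski form.

   Conversely, if G = F^-1 pulls solutions of the wave equation back to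
   solutions, then a.x and (a.x)^2 with a null show that the components of G are
   harmonic and that G is conformal.  Contracting the Christoffel symbols of the
   conformal metric with harmonic coordinates gives (1 - n) d(lambda) = 0 for the
   conformal factor lambda.  So lambda is constant, D^2 G = 0, and the sign
   condition fixes the time orientation. *)

Require Import Defs.
From Stdlib Require Import Reals Lra FunctionalExtensionality.
From mathcomp Require Import all_boot all_order all_algebra.
From mathcomp Require Import Rstruct.
From Coquelicot Require Import Coquelicot.
Set Implicit Arguments. Unset Strict Implicit. Unset Printing Implicit Defensive.
Open Scope R_scope.

(** * Calculus on [Pt n] *)

Lemma filter_forall_ord (T : Type) (F : (T -> Prop) -> Prop) (FF : Filter F) m
  (Q : 'I_m -> T -> Prop) : (forall i, F (Q i)) -> F (fun t => forall i, Q i t).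
Proof.
move=> H.
have : F (fun t => forall i, i \in enum 'I_m -> Q i t).
  elim: (enum _) => [|a s IH]; first by apply: filter_forall => t i.
  apply: filter_imp (filter_and _ _ (H a) IH) => t [h1 h2] i.
  by rewrite inE => /orP[/eqP->|/h2].
by apply: filter_imp => t h i; apply: h; rewrite mem_enum.
Qed.

Lemma derivable_pt_lim_sum m (f : 'I_m -> R -> R) (l : 'I_m -> R) t :
  (forall j, derivable_pt_lim (f j) t (l j)) ->
  derivable_pt_lim (fun s => (\sum_j f j s)%R) t (\sum_j l j)%R.
Proof.
move=> H; elim: (index_enum _) => [|a s IH].
  have -> : (fun x => (\sum_(j <- [::]) f j x)%R) = fun _ => 0.
    by apply: functional_extensionality => x; rewrite big_nil.
  by rewrite big_nil; apply: derivable_pt_lim_const.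
have -> : (fun x => (\sum_(j <- a :: s) f j x)%R) = fun x => f a x + (\sum_(j <- s) f j x)%R.
  by apply: functional_extensionality => x; rewrite big_cons.
by rewrite big_cons; apply: derivable_pt_lim_plus.
Qed.

(** Chain rule in Carathéodory form: the increment of [psi] is the increment of [c] times a factor
    tending to [q0]. The increment of [c] may vanish, since it is never divided by. *)
Lemma derivable_pt_lim_factor (c psi : R -> R) t l q0 : derivable_pt_lim c t l ->
  (forall eps, 0 < eps -> exists d : posreal, forall h, Rabs h < d ->
     exists q, Rabs (q - q0) < eps /\ psi (t + h) - psi t = q * (c (t + h) - c t)) ->
  derivable_pt_lim psi t (q0 * l).
Proof.
move=> hc H eps e0.
have a0 := Rabs_pos q0; have l0 := Rabs_pos l.
pose e1 := Rmin 1 (eps / (2 * (Rabs q0 + 1))).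
have e10 : 0 < e1 by apply: Rmin_pos; [lra | apply: Rdiv_lt_0_compat; lra].
have e20 : 0 < eps / (2 * (Rabs l + 1)) by apply: Rdiv_lt_0_compat; lra.
have [d1 h1] := hc _ e10; have [d2 h2] := H _ e20.
have m0 : 0 < Rmin d1 d2 by apply: Rmin_pos; apply: cond_pos.
exists (mkposreal _ m0) => h hn0 /= hd.
have {}h1 := h1 h hn0 (Rlt_le_trans _ _ _ hd (Rmin_l _ _)).
have [q [hq ->]] := h2 h (Rlt_le_trans _ _ _ hd (Rmin_r _ _)).
set D := (c (t + h) - c t) / h in h1 *.
have -> : q * (c (t + h) - c t) / h - q0 * l = (q - q0) * D + q0 * (D - l).
  by rewrite /D; field.
have D1 : Rabs (D - l) < 1 by apply: Rlt_le_trans h1 (Rmin_l _ _).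
have D2 : Rabs (D - l) < eps / (2 * (Rabs q0 + 1)) by apply: Rlt_le_trans h1 (Rmin_r _ _).
have DB : Rabs D <= Rabs l + 1.
  have := Rabs_triang (D - l) l; have -> : D - l + l = D by ring.
  lra.
apply: Rle_lt_trans (Rabs_triang _ _) _; rewrite (Rabs_mult _ D) (Rabs_mult q0).
have b1 : Rabs (q - q0) * Rabs D <= Rabs (q - q0) * (Rabs l + 1).
  by apply: Rmult_le_compat_l => //; apply: Rabs_pos.
have b2 : Rabs (q - q0) * (Rabs l + 1) < eps / 2.
  have -> : eps / 2 = eps / (2 * (Rabs l + 1)) * (Rabs l + 1) by field; lra.
  by apply: Rmult_lt_compat_r => //; lra.
have b3 : Rabs q0 * Rabs (D - l) <= eps / 2.
  have -> : eps / 2 = (Rabs q0 + 1) * (eps / (2 * (Rabs q0 + 1))) by field; lra.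
  by apply: Rmult_le_compat; try lra; apply: Rabs_pos.
lra.
Qed.

Section Calculus.
Variable n : nat.
Local Notation P := (Pt n).
Local Notation shift := (Defs.shift n).
Local Notation is_partial := (Defs.is_partial n).
Local Notation continuous_fun := (Defs.continuous_fun n).
Local Notation Ck := (Defs.Ck n).
Local Notation smooth := (Defs.smooth n).
Implicit Types (f g phi : P -> R) (x y : P) (i j : 'I_n.+1).

(** [Derive] is total, so [pd] is a partial derivative only where one exists. *)
Definition pd f i x : R := Derive (fun t => f (shift x i t)) 0.

Lemma shift0 x i : shift x i 0 = x.
Proof. by apply: functional_extensionality => j; rewrite /shift; case: ifP => _; rewrite ?Rplus_0_r. Qed.

Lemma shiftD x i s t : shift (shift x i s) i t = shift x i (s + t).
Proof.
by apply: functional_extensionality => j; rewrite /shift; case: ifP => E; rewrite ?E ?Rplus_assoc //.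
Qed.

Lemma shiftC x i j s t : i != j -> shift (shift x i s) j t = shift (shift x j t) i s.
Proof.
move=> ij; apply: functional_extensionality => k; rewrite /shift.
by case: eqP => // ->; rewrite eq_sym (negPf ij).
Qed.

Lemma is_partial_pd f i x l : is_partial f i x l -> pd f i x = l.
Proof. by move=> /is_derive_Reals /is_derive_unique. Qed.

Lemma is_partial_shift f i x t l : is_partial f i (shift x i t) l ->
  is_derive (fun s => f (shift x i s)) t l.
Proof.
move=> H; apply/is_derive_Reals => eps e0; have [d h] := H eps e0.
by exists d => s s0 sd; have := h s s0 sd; rewrite /= !shiftD Rplus_0_r Rplus_0_l.
Qed.

(** * Continuity through neighbourhood filters *)

Definition nb x (Q : P -> Prop) : Prop := exists d : posreal,
  forall y, (forall i, Rabs (y i - x i) < d) -> Q y.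

Global Instance nb_filter x : ProperFilter (nb x).
Proof.
split.
  by move=> Q [d h]; exists x; apply: h => i; rewrite Rminus_diag Rabs_R0; apply: cond_pos.
split.
- by exists (mkposreal 1 Rlt_0_1).
- move=> Q Q' [d h] [d' h'].
  have m0 : 0 < Rmin d d' by apply: Rmin_pos; apply: cond_pos.
  exists (mkposreal _ m0) => y /= hy; split; [apply: h|apply: h'] => i.
    exact: Rlt_le_trans (hy i) (Rmin_l _ _).
  exact: Rlt_le_trans (hy i) (Rmin_r _ _).
- by move=> Q Q' QQ [d h]; exists d => y hy; apply: QQ; apply: h.
Qed.

Lemma continuous_funP f : continuous_fun f <-> forall x, filterlim f (nb x) (locally (f x)).
Proof.
split=> [H x|H x eps e0].
  apply/filterlim_locally => eps; have [d [d0 h]] := H x eps (cond_pos eps).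
  by exists (mkposreal d d0) => y hy; apply: h.
have /filterlim_locally /(_ (mkposreal eps e0)) [d h] := H x.
by exists d; split; [apply: cond_pos | move=> y hy; apply: h].
Qed.

Lemma filterlim_nb (T : Type) (F : (T -> Prop) -> Prop) (FF : Filter F) (G : T -> P) x :
  (forall i, filterlim (fun t => G t i) F (locally (x i))) -> filterlim G F (nb x).
Proof.
move=> H Q [d h]; rewrite /filtermap.
have : F (fun t => forall i, Rabs (G t i - x i) < d).
  apply: filter_forall_ord => i.
  by have /filterlim_locally /(_ d) := H i.
by apply: filter_imp => t; apply: h.
Qed.

Lemma continuous_fun_const c : continuous_fun (fun _ : P => c).
Proof. by apply/continuous_funP => x; apply: filterlim_const. Qed.

Lemma continuous_fun_coord i : continuous_fun (fun x : P => x i).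
Proof. by move=> x eps e0; exists eps; split. Qed.

Lemma continuous_fun_add f g : continuous_fun f -> continuous_fun g ->
  continuous_fun (fun x => f x + g x).
Proof.
move=> /continuous_funP hf /continuous_funP hg; apply/continuous_funP => x.
apply: filterlim_comp_2 (hf x) (hg x) _.
exact: (@filterlim_plus _ R_NormedModule).
Qed.

Lemma continuous_fun_mul f g : continuous_fun f -> continuous_fun g ->
  continuous_fun (fun x => f x * g x).
Proof.
move=> /continuous_funP hf /continuous_funP hg; apply/continuous_funP => x.
apply: filterlim_comp_2 (hf x) (hg x) _.
exact: (@filterlim_mult R_AbsRing).
Qed.

Lemma continuous_fun_comp f (G : P -> P) : continuous_fun f ->
  (forall i, continuous_fun (fun x => G x i)) -> continuous_fun (fun x => f (G x)).
Proof.
move=> /continuous_funP hf hG; apply/continuous_funP => x.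
apply: filterlim_comp (hf (G x)); apply: filterlim_nb => i.
by have /continuous_funP := hG i.
Qed.

(** * Functions of class C^k and smooth functions *)

Lemma CkW k f : Ck k.+1 f -> Ck k f.
Proof.
elim: k f => [|k IH] f [cf H]; first by [].
by split=> // i; have [g [hg cg]] := H i; exists g; split; last exact: IH.
Qed.

Lemma smooth_continuous f : smooth f -> continuous_fun f.
Proof. by move=> /(_ 0%N). Qed.

Lemma smooth_partial f i x : smooth f -> is_partial f i x (pd f i x).
Proof.
by move=> /(_ 1%N) [_ /(_ i) [g [hg _]]]; rewrite (is_partial_pd (hg x)).
Qed.

Lemma smooth_pd f i : smooth f -> smooth (pd f i).
Proof.
move=> sf k; have [_ /(_ i) [g [hg cg]]] := sf k.+1.
suff -> : pd f i = g by [].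
by apply: functional_extensionality => x; apply: is_partial_pd.
Qed.

Lemma Ck_const k c : Ck k (fun _ : P => c).
Proof.
elim: k c => [|k IH] c; first exact: continuous_fun_const.
split=> [|i]; first exact: continuous_fun_const.
by exists (fun _ => 0); split=> // x; apply: derivable_pt_lim_const.
Qed.

Lemma is_partial_coord i j x : is_partial (fun x : P => x j) i x (if j == i then 1 else 0).
Proof.
rewrite /is_partial /shift; case: eqP => _; last exact: derivable_pt_lim_const.
rewrite -[1]Rplus_0_l; apply: (derivable_pt_lim_plus (fun _ => x j) id).
  exact: derivable_pt_lim_const.
exact: derivable_pt_lim_id.
Qed.

Lemma Ck_coord k i : Ck k (fun x : P => x i).
Proof.
case: k => [|k]; first exact: continuous_fun_coord.
split=> [|j]; first exact: continuous_fun_coord.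
exists (fun _ => if i == j then 1 else 0); split; last exact: Ck_const.
by move=> x; apply: is_partial_coord.
Qed.

Lemma is_partial_add f g i x a b : is_partial f i x a -> is_partial g i x b ->
  is_partial (fun x => f x + g x) i x (a + b).
Proof. exact: derivable_pt_lim_plus. Qed.

Lemma is_partial_mul f g i x a b : is_partial f i x a -> is_partial g i x b ->
  is_partial (fun x => f x * g x) i x (a * g x + f x * b).
Proof.
move=> ha hb; have := derivable_pt_lim_mult _ _ _ _ _ ha hb.
by rewrite shift0.
Qed.

Lemma Ck_add k f g : Ck k f -> Ck k g -> Ck k (fun x => f x + g x).
Proof.
elim: k f g => [|k IH] f g; first exact: continuous_fun_add.
move=> [cf hf] [cg hg]; split=> [|i]; first exact: continuous_fun_add.
have [f' [pf kf]] := hf i; have [g' [pg kg]] := hg i.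
exists (fun x => f' x + g' x); split; last exact: IH.
by move=> x; apply: is_partial_add.
Qed.

Lemma Ck_mul k f g : Ck k f -> Ck k g -> Ck k (fun x => f x * g x).
Proof.
elim: k f g => [|k IH] f g; first exact: continuous_fun_mul.
(* The product rule keeps [f] and [g] themselves as factors, so the induction hypothesis is applied
   to them at order [k] too. *)
move=> kf1 kg1; have kf0 := CkW kf1; have kg0 := CkW kg1.
move: kf1 kg1 => [cf hf] [cg hg]; split=> [|i]; first exact: continuous_fun_mul.
have [f' [pf kf]] := hf i; have [g' [pg kg]] := hg i.
exists (fun x => f' x * g x + f x * g' x); split; last by apply: Ck_add; apply: IH.
by move=> x; apply: is_partial_mul.
Qed.

Lemma Ck_sum k m (f : 'I_m -> P -> R) : (forall j : 'I_m, Ck k (f j)) ->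
  Ck k (fun x => (\sum_j f j x)%R).
Proof.
move=> H; elim: (index_enum _) => [|a s IH].
  have -> : (fun x => (\sum_(j <- [::]) f j x)%R) = fun _ => 0.
    by apply: functional_extensionality => x; rewrite big_nil.
  exact: Ck_const.
have -> : (fun x => (\sum_(j <- a :: s) f j x)%R) = fun x => f a x + (\sum_(j <- s) f j x)%R.
  by apply: functional_extensionality => x; rewrite big_cons.
exact: Ck_add.
Qed.

(** * Mean value theorem, chain rule, symmetry of second derivatives *)

Lemma partial_mvt f (g : P -> R) i x a : (forall y, is_partial f i y (g y)) ->
  exists s, Rabs s <= Rabs a /\ f (shift x i a) - f x = g (shift x i s) * a.
Proof.
move=> H; have D t := is_partial_shift (H (shift x i t)).
have [t _|t _|s [hs e]] := MVT_gen (fun t => f (shift x i t)) 0 a (fun t => g (shift x i t)).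
- exact: D.
- by apply/continuity_pt_filterlim/ex_derive_continuous; exists (g (shift x i t)).
exists s; split; last by move: e; rewrite shift0 Rminus_0_r.
move: hs; rewrite /Rmin /Rmax /Rabs.
by do 3 (case: Rle_dec || case: Rcase_abs); move=> *; lra.
Qed.

(** The way from [c t] to [c s] is walked one coordinate at a time; the mean value theorem turns
    each step into a partial derivative at a nearby point. *)
Lemma chain_rule_curve phi (g : 'I_n.+1 -> P -> R) (c : R -> P) t (l : 'I_n.+1 -> R) :
  (forall j x, is_partial phi j x (g j x)) -> (forall j, continuous_fun (g j)) ->
  (forall j, derivable_pt_lim (fun s => c s j) t (l j)) ->
  derivable_pt_lim (fun s => phi (c s)) t (\sum_j g j (c t) * l j)%R.
Proof.
move=> hg cg hc.
(* The first [k] coordinates come from [c s] and the others from [c t], so the sum over [k]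
   telescopes from [c t] to [c s]. *)
pose m k s : P := fun j => if (nat_of_ord j < k)%N then c s j else c t j.
have mt k : m k t = c t by apply: functional_extensionality => j; rewrite /m; case: ifP.
have mS (k : 'I_n.+1) s : m k.+1 s = shift (m k s) k (c s k - c t k).
  apply: functional_extensionality => j; rewrite /shift /m ltnS leq_eqVlt.
  have -> : (nat_of_ord j == k) = (j == k) by [].
  by case: eqVneq => [->|_] //=; rewrite ltnn; ring.
have -> : (fun s => phi (c s)) =
   fun s => phi (c t) + (\sum_(j < n.+1) (phi (m j.+1 s) - phi (m j s)))%R.
  apply: functional_extensionality => s.
  have -> : (\sum_(j < n.+1) (phi (m j.+1 s) - phi (m j s)) = phi (c s) - phi (c t))%R.
    rewrite -(big_mkord xpredT (fun j : nat => phi (m j.+1 s) - phi (m j s))%R) GRing.telescope_sumr //.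
    congr (phi _ - phi _)%R; apply: functional_extensionality => j; rewrite /m //.
    by rewrite ltn_ord.
  by rewrite -!RealsE; ring.
rewrite -[X in derivable_pt_lim _ _ X]Rplus_0_l.
apply: (derivable_pt_lim_plus (fun _ => phi (c t))); first exact: derivable_pt_lim_const.
apply: derivable_pt_lim_sum => k; apply: derivable_pt_lim_factor (hc k) _ => eps e0.
have [d [d0 hd]] := cg k (c t) eps e0.
have : locally t (fun s => forall j, Rabs (c s j - c t j) < d).
  apply: filter_forall_ord => j.
  have : continuous (fun s => c s j) t.
    by apply: ex_derive_continuous; exists (l j); apply/is_derive_Reals.
  by move=> /filterlim_locally /(_ (mkposreal d d0)).
move=> [d' hd']; exists d' => h hh.
have {}hd' j : Rabs (c (t + h) j - c t j) < d.
  by apply: hd'; rewrite /ball /= /AbsRing_ball /abs /minus /plus /opp /=; move: hh; congr (Rabs _ < _); ring.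
rewrite !mt; have [s [hs e]] := partial_mvt (m k (t + h)) (c (t + h) k - c t k) (hg k).
(* At the mean value point every coordinate is within [d] of that of [c t], so continuity of [g k]
   applies. *)
exists (g k (shift (m k (t + h)) k s)); split; last first.
  by rewrite mS -e -!RealsE; ring.
apply: hd => j; rewrite /shift /m; case: eqVneq => [->|_].
  rewrite ltnn; have -> : c t k + s - c t k = s by ring.
  exact: Rle_lt_trans hs (hd' k).
by case: ifP => _ //; rewrite Rminus_diag Rabs_R0.
Qed.

Lemma smooth_chain phi (c : R -> P) t (l : 'I_n.+1 -> R) : smooth phi ->
  (forall j, derivable_pt_lim (fun s => c s j) t (l j)) ->
  derivable_pt_lim (fun s => phi (c s)) t (\sum_j pd phi j (c t) * l j)%R.
Proof.
move=> sphi; apply: (@chain_rule_curve phi (pd phi)) => j.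
  by move=> x; apply: smooth_partial.
by apply/smooth_continuous/smooth_pd.
Qed.

Lemma is_partial_comp phi (G : P -> P) i x : smooth phi -> smooth_map n G ->
  is_partial (fun y => phi (G y)) i x (\sum_j pd phi j (G x) * pd (fun y => G y j) i x)%R.
Proof.
move=> sphi sG; rewrite -[x in G x](shift0 x i).
by apply: smooth_chain sphi _ => j; apply: smooth_partial.
Qed.

Lemma smooth_comp phi (G : P -> P) : smooth phi -> smooth_map n G -> smooth (fun x => phi (G x)).
Proof.
(* The induction ranges over all smooth [phi], because the chain rule composes the partials of [phi]
   with [G]. *)
move=> sphi sG k; elim: k phi sphi => [|k IH] phi sphi; first apply: continuous_fun_comp.
- exact: smooth_continuous.
- by move=> i; apply: smooth_continuous.
split=> [|i].
  by apply: continuous_fun_comp => [|j]; apply: smooth_continuous.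
exists (fun x => (\sum_j pd phi j (G x) * pd (fun y => G y j) i x)%R); split=> [x|].
  exact: is_partial_comp.
apply: Ck_sum => j; apply: Ck_mul; first by apply: IH; apply: smooth_pd.
exact: (smooth_pd i (sG j)).
Qed.

(** Along the segment from [x] to [y] the derivative is constant, so the mean value theorem gives
    the increment exactly. *)
Lemma constant_partials_affine f (a : 'I_n.+1 -> R) x y : (forall i x, is_partial f i x (a i)) ->
  f y = f x + (\sum_i a i * (y i - x i))%R.
Proof.
move=> H; pose c t : P := fun i => x i + t * (y i - x i).
have D t : is_derive (fun s => f (c s)) t (\sum_i a i * (y i - x i))%R.
  apply/is_derive_Reals; apply: (@chain_rule_curve f (fun i _ => a i)) => i //.
    exact: continuous_fun_const.
  by apply/is_derive_Reals; rewrite /c -RminusE; auto_derive => //; ring.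
have [t _|t _|s [_]] := MVT_gen (fun t => f (c t)) 0 1 (fun _ => (\sum_i a i * (y i - x i))%R).
- exact: D.
- by apply/continuity_pt_filterlim/ex_derive_continuous; eexists; apply: D.
have -> : c 1 = y by apply: functional_extensionality => i; rewrite /c; ring.
have -> : c 0 = x by apply: functional_extensionality => i; rewrite /c; ring.
by move=> e; lra.
Qed.

(** Schwarz's theorem for the restriction of [f] to the plane through [x] in directions [i] and [j];
    for distinct indices the two shifts commute. *)
Lemma pdC f i j x : smooth f -> pd (pd f i) j x = pd (pd f j) i x.
Proof.
move=> sf; have [->//|ij] := eqVneq i j.
pose h u v := f (shift (shift x i u) j v).
have D1 g u v : smooth g -> is_derive (fun z => g (shift (shift x i u) j z)) v
    (pd g j (shift (shift x i u) j v)).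
  by move=> sg; apply/is_partial_shift/smooth_partial.
have D2 g u v : smooth g -> is_derive (fun z => g (shift (shift x i z) j v)) u
    (pd g i (shift (shift x i u) j v)).
  move=> sg; apply: (is_derive_ext (fun z => g (shift (shift x j v) i z))).
    by move=> z; rewrite shiftC // eq_sym.
  by rewrite shiftC //; apply/is_partial_shift/smooth_partial.
have e1 u v : Derive (fun z => h u z) v = pd f j (shift (shift x i u) j v).
  exact/is_derive_unique/D1.
have e2 u v : Derive (fun z => h z v) u = pd f i (shift (shift x i u) j v).
  exact/is_derive_unique/D2.
have e12 u v : Derive (fun z => Derive (fun t => h z t) v) u =
   pd (pd f j) i (shift (shift x i u) j v).
  rewrite (Derive_ext _ (fun z => pd f j (shift (shift x i z) j v))) //.
  exact/is_derive_unique/D2/smooth_pd.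
have e21 u v : Derive (fun z => Derive (fun t => h t z) u) v =
   pd (pd f i) j (shift (shift x i u) j v).
  rewrite (Derive_ext _ (fun z => pd f i (shift (shift x i u) j z))) //.
  exact/is_derive_unique/D1/smooth_pd.
have C g : smooth g -> continuity_2d_pt (fun u v => g (shift (shift x i u) j v)) 0 0.
  move=> sg eps; have [d [d0 hd]] := smooth_continuous sg (shift (shift x i 0) j 0) (cond_pos eps).
  exists (mkposreal d d0) => u v /= hu hv; apply: hd => k; rewrite /shift.
  case: eqVneq => [->|_]; case: eqVneq => [ji|_].
  - by rewrite ji eqxx in ij.
  - by move: hv; congr (Rabs _ < _); ring.
  - by move: hu; congr (Rabs _ < _); ring.
  - by rewrite Rminus_diag Rabs_R0.
have := @Schwarz h 0 0; rewrite e12 e21 !shift0 => -> //.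
- exists (mkposreal 1 Rlt_0_1) => u v _ _; split; first by eexists; apply: D2.
  split; first by eexists; apply: D1.
  split.
    apply: (ex_derive_ext (fun z => pd f j (shift (shift x i z) j v))); first by move=> z; rewrite e1.
    by eexists; apply/D2/smooth_pd.
  apply: (ex_derive_ext (fun z => pd f i (shift (shift x i u) j z))); first by move=> z; rewrite e2.
  by eexists; apply/D1/smooth_pd.
- apply: continuity_2d_pt_ext (C _ (smooth_pd i (smooth_pd j sf))) => u v.
  by rewrite e12.
- apply: continuity_2d_pt_ext (C _ (smooth_pd j (smooth_pd i sf))) => u v.
  by rewrite e21.
Qed.

End Calculus.

(** * Minkowski linear algebra *)

From mathcomp Require Import ring lra.
Import Order.TTheory GRing.Theory Num.Theory.

Section MinkowskiAlgebra.
Local Open Scope ring_scope.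
Variables (R : realFieldType) (n : nat).
Local Notation W := 'cV[R]_n.+1.
Implicit Types (u v w x y : W) (S A B : 'M[R]_n.+1).

Definition bil S u v : R := (u^T *m S *m v) 0 0.

Lemma bilDl S u v w : bil S (u + v) w = bil S u w + bil S v w.
Proof. by rewrite /bil linearD /= !mulmxDl mxE. Qed.
Lemma bilDr S u v w : bil S w (u + v) = bil S w u + bil S w v.
Proof. by rewrite /bil mulmxDr mxE. Qed.
Lemma bilZl S a u w : bil S (a *: u) w = a * bil S u w.
Proof. by rewrite /bil linearZ /= -!scalemxAl mxE. Qed.
Lemma bilZr S a u w : bil S w (a *: u) = a * bil S w u.
Proof. by rewrite /bil -!scalemxAr mxE. Qed.
Lemma bilNl S u w : bil S (- u) w = - bil S u w.
Proof. by rewrite -scaleN1r bilZl mulN1r. Qed.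
Lemma bilNr S u w : bil S w (- u) = - bil S w u.
Proof. by rewrite -scaleN1r bilZr mulN1r. Qed.
Lemma bil0l S u : bil S 0 u = 0.
Proof. by rewrite -(scale0r 0) bilZl mul0r. Qed.
Lemma bil0r S u : bil S u 0 = 0.
Proof. by rewrite -(scale0r 0) bilZr mul0r. Qed.

Lemma bilC S : S^T = S -> forall u v, bil S u v = bil S v u.
Proof.
move=> symS u v; rewrite /bil -[in LHS](trmxK (u^T *m S *m v)) mxE.
by rewrite !trmx_mul trmxK symS mulmxA.
Qed.

Lemma bil_mul S A B u v : bil S (A *m u) (B *m v) = bil (A^T *m S *m B) u v.
Proof. by rewrite /bil trmx_mul !mulmxA. Qed.

Lemma bil_scale a S u v : bil (a *: S) u v = a * bil S u v.
Proof. by rewrite /bil -scalemxAr -scalemxAl mxE. Qed.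

Definition evec (i : 'I_n.+1) : W := delta_mx i 0.

Lemma bil_evec S i j : bil S (evec i) (evec j) = S i j.
Proof. by rewrite /bil /evec trmx_delta -rowE -colE !mxE. Qed.

Definition eta (i : 'I_n.+1) : R := if i == ord_max then -1 else 1.
Definition etam : 'M[R]_n.+1 := diag_mx (\row_i eta i).
Definition mq u v := bil etam u v.
Definition tm u : R := u ord_max 0.

Lemma eta_max : eta ord_max = -1. Proof. by rewrite /eta eqxx. Qed.
Lemma eta_sp i : i != ord_max -> eta i = 1. Proof. by rewrite /eta => /negPf->. Qed.
Lemma eta_sqr i : eta i * eta i = 1.
Proof. by rewrite /eta; case: ifP => _; ring. Qed.

Lemma etam_sym : etam^T = etam. Proof. exact: tr_diag_mx. Qed.

Lemma etamE i j : etam i j = eta i *+ (i == j).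
Proof. by rewrite !mxE. Qed.

Lemma etamK : etam *m etam = 1%:M.
Proof.
rewrite /etam mulmx_diag; apply/matrixP => i j; rewrite !mxE.
by rewrite eta_sqr.
Qed.

Lemma mqC u v : mq u v = mq v u. Proof. exact: bilC etam_sym _ _. Qed.

Lemma mqE u v : mq u v = \sum_i eta i * (u i 0 * v i 0).
Proof.
rewrite /mq /bil mxE; apply: eq_bigr => i _.
by rewrite mul_mx_diag !mxE mulrCA -mulrA.
Qed.

Definition mq_lin := (bilDl, bilDr, bilZl, bilZr, bilNl, bilNr).

(** On the hyperplane of time zero the form is a sum of squares. Later estimates combine vectors so
    that their time components cancel and then use this. *)
Lemma mq_rest u : tm u = 0 -> 0 <= mq u u ?= iff (u == 0).
Proof.
move=> u0.
have -> : mq u u = \sum_(i < n.+1) (u i 0) ^+ 2.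
  rewrite mqE; apply: eq_bigr => i _; have [->|ni] := eqVneq i ord_max.
    by rewrite -[u _ _]/(tm u) u0; ring.
  by rewrite eta_sp // mul1r expr2.
have H (i : 'I_n.+1) : true -> 0 <= (u i 0) ^+ 2 ?= iff (u i 0 == 0).
  by move=> _; split; [exact: sqr_ge0 | rewrite eq_sym sqrf_eq0].
have [le_ eq_] := leif_sum H; rewrite big1 in le_ eq_ => //.
split => //; rewrite eq_; apply/forallP/eqP => [h|-> i].
  by apply/colP => i; rewrite mxE; apply/eqP/h.
by rewrite mxE eqxx.
Qed.

Lemma mqNN u : mq (- u) (- u) = mq u u.
Proof. by rewrite /mq bilNl bilNr opprK. Qed.

Lemma evecE i j : evec i j 0 = (j == i)%:R.
Proof. by rewrite mxE eqxx andbT. Qed.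

Lemma tmB u v : tm (u - v) = tm u - tm v.
Proof. by rewrite /tm !mxE. Qed.
Lemma tmD u v : tm (u + v) = tm u + tm v.
Proof. by rewrite /tm !mxE. Qed.
Lemma tmN u : tm (- u) = - tm u.
Proof. by rewrite /tm !mxE. Qed.
Lemma tmZ a u : tm (a *: u) = a * tm u.
Proof. by rewrite /tm !mxE. Qed.
Lemma tm0 : tm 0 = 0.
Proof. by rewrite /tm !mxE. Qed.

Lemma tm_neq0 u : mq u u <= 0 -> u != 0 -> tm u != 0.
Proof.
move=> qu; apply: contraNneq => /mq_rest [ge e].
by rewrite -e eq_sym; apply/eqP/le_anti; rewrite qu ge.
Qed.

(* Subtracting from [d] the multiple of [v] with the same time component leaves a
   vector orthogonal to the time axis whose square is nonpositive. *)
Lemma orth_null_parallel v d : mq v v = 0 -> v != 0 -> mq d v = 0 ->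
  mq d d <= 0 -> d = (tm d / tm v) *: v.
Proof.
move=> qv v0 dv dd; have tv : tm v != 0 by apply: tm_neq0; rewrite ?qv.
apply/eqP; rewrite -subr_eq0.
have [|ge e] := @mq_rest (d - (tm d / tm v) *: v).
  by rewrite tmB tmZ divfK // subrr.
rewrite -e eq_sym; apply/eqP/le_anti; rewrite ge andbT.
have -> : mq (d - (tm d / tm v) *: v) (d - (tm d / tm v) *: v) = mq d d.
  rewrite /mq !mq_lin -!/(mq _ _) (mqC v d) qv dv; ring.
exact: dd.
Qed.

(** * The closed future cone *)

Definition cone u := (mq u u <= 0) && (0 <= tm u).

Lemma coneP u : reflect (mq u u <= 0 /\ 0 <= tm u) (cone u).
Proof. exact: andP. Qed.

(** The combination [tm w *: u - tm u *: w] has time zero, hence nonnegative square; its cross term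
    carries [mq u w] with a negative coefficient. *)
Lemma cone_mq_le0 u w : cone u -> cone w -> mq u w <= 0.
Proof.
move=> /coneP[qu tu] /coneP[qw tw].
have [->|u0] := eqVneq u 0; first by rewrite /mq bil0l.
have [->|w0] := eqVneq w 0; first by rewrite /mq bil0r.
have tu' : 0 < tm u by rewrite lt_def tu tm_neq0.
have tw' : 0 < tm w by rewrite lt_def tw tm_neq0.
have [|ge _] := @mq_rest (tm w *: u - tm u *: w).
  by rewrite tmB !tmZ; ring.
move: ge; rewrite /mq !mq_lin -!/(mq _ _) (mqC w u) => ge.
have h1 : tm w * (tm w * mq u u) <= 0 by rewrite !mulr_ge0_le0.
have h2 : tm u * (tm u * mq w w) <= 0 by rewrite !mulr_ge0_le0.
have h3 : 0 < tm u * tm w by rewrite mulr_gt0.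
have : tm u * tm w * mq u w <= 0 by lra.
by rewrite pmulr_rle0.
Qed.

Lemma coneZ a u : 0 <= a -> cone u -> cone (a *: u).
Proof.
move=> a0 /coneP[qu tu]; apply/coneP; split; last by rewrite tmZ mulr_ge0.
by rewrite /mq !mq_lin !mulr_ge0_le0.
Qed.

Lemma cone_total u : mq u u <= 0 -> cone u || cone (- u).
Proof.
move=> qu; rewrite /cone mqNN qu /= tmN oppr_ge0.
exact: le_total.
Qed.

Lemma cone_le0 u : cone u || cone (- u) -> mq u u <= 0.
Proof.
by move=> /orP[] /coneP[] //; rewrite mqNN.
Qed.

Lemma cone0 : cone 0.
Proof. by apply/coneP; rewrite /mq bil0l tm0. Qed.

Lemma cone_antisym u : cone u -> cone (- u) -> u = 0.
Proof.
move=> /coneP[qu tu] /coneP[_]; rewrite tmN => tu'.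
apply/eqP; apply: contraT => u0; have := tm_neq0 qu u0.
have -> : tm u = 0 by lra.
by rewrite eqxx.
Qed.

Lemma mq_evec i j : mq (evec i) (evec j) = eta i *+ (i == j).
Proof. by rewrite /mq bil_evec etamE. Qed.

Lemma mq_evec_max d : mq (evec ord_max) d = - tm d.
Proof.
rewrite mqE (bigD1 ord_max) //= big1 ?addr0; last first.
  by move=> i ni; rewrite evecE (negPf ni) mul0r mulr0.
by rewrite evecE eqxx eta_max mul1r mulN1r.
Qed.

(** The null vectors [t + e_i] and [t - e_i], with [t] the time axis, kill the mixed entries and fix
    the diagonal; a third family of null vectors kills the remaining entries. *)
Lemma null_form S : S^T = S ->
  (forall v, mq v v = 0 -> bil S v v = 0) ->
  S = (- S ord_max ord_max) *: etam.
Proof.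
move=> symS H; have Ssym i j : S i j = S j i by rewrite -{1}symS mxE.
have tt : mq (evec ord_max) (evec ord_max) = -1 by rewrite mq_evec eqxx eta_max.
have ii i : i != ord_max -> mq (evec i) (evec i) = 1.
  by move=> ni; rewrite mq_evec eqxx eta_sp.
have ij i j : i != j -> mq (evec i) (evec j) = 0.
  by move=> nij; rewrite mq_evec (negPf nij).
have h1 i : i != ord_max -> S i ord_max = 0 /\ S i i = - S ord_max ord_max.
  move=> ni.
  have := H (evec ord_max + evec i); have := H (evec ord_max - evec i).
  rewrite /mq !mq_lin -!/(mq _ _) tt ii // (mqC (evec ord_max)) ij //.
  rewrite !bil_evec (Ssym ord_max i) => a b.
  have {}a : S ord_max ord_max - S i ord_max + (- S i ord_max - - S i i) = 0.
    by rewrite -a; ring.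
  have {}b : S ord_max ord_max + S i ord_max + (S i ord_max + S i i) = 0.
    by rewrite -b; ring.
  split; lra.
have h2 i j : i != ord_max -> j != ord_max -> i != j -> S i j = 0.
  move=> ni nj nij; have [it is_] := h1 _ ni; have [jt js] := h1 _ nj.
  (* This vector is null because 3, 4, 5 is a Pythagorean triple; the diagonal terms cancel for the
     same reason and only [24 * S i j] survives. *)
  have := H (5 *: evec ord_max + 3 *: evec i + 4 *: evec j).
  rewrite /mq !mq_lin -!/(mq _ _) tt !ii // !(mqC (evec ord_max)) (mqC (evec j) (evec i)) (ij i j) // (ij i ord_max) // (ij j ord_max) //.
  rewrite !bil_evec !(Ssym ord_max) it jt is_ js (Ssym j i) => a.
  have : 24 * S i j = 0 by rewrite -a; lra.
  lra.
apply/matrixP => i j; rewrite mxE etamE.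
have [->|nij] := eqVneq i j.
  have [->|nj] := eqVneq j ord_max; first by rewrite eta_max mulr1n mulrN1 opprK.
  by have [_ ->] := h1 _ nj; rewrite eta_sp // mulr1n mulr1.
rewrite mulr0n mulr0.
have [ei|ni] := eqVneq i ord_max.
  by rewrite ei Ssym; case: (h1 j) => //; rewrite -ei eq_sym.
have [->|nj] := eqVneq j ord_max; first by case: (h1 i).
exact: h2.
Qed.

(** In the expansion of the square all terms are nonpositive, so each of them vanishes. *)
Lemma null_cone_eq0 u w : cone u -> cone w -> mq (u + w) (u + w) = 0 ->
  [/\ mq u u = 0, mq w w = 0 & mq u w = 0].
Proof.
move=> cu cw; have uw := cone_mq_le0 cu cw.
move: cu cw => /coneP[qu _] /coneP[qw _].
rewrite /mq !mq_lin -!/(mq _ _) (mqC w u) => e; split; lra.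
Qed.

Lemma null_parallel u w : mq u u = 0 -> mq w w = 0 -> mq (u - w) (u - w) = 0 ->
  u != 0 -> w = (tm w / tm u) *: u.
Proof.
rewrite {3}/mq !mq_lin -!/(mq _ _) => qu qw; rewrite qu qw (mqC w u) => e u0.
by apply: orth_null_parallel => //; rewrite ?qw // mqC; lra.
Qed.

(** A null [z] splits as a sum of two cone vectors only along its own line, so [u] and [w] are
    multiples of [z] and are ordered by their coefficients. *)
Lemma cone_chain_null z u w : cone z -> mq z z = 0 -> cone u -> cone (z - u) ->
  cone w -> cone (z - w) -> cone (u - w) || cone (w - u).
Proof.
move=> cz qz cu czu cw czw.
have [z0|z0] := eqVneq z 0.
  rewrite z0 !sub0r in czu czw.
  by rewrite (cone_antisym cu czu) (cone_antisym cw czw) subr0 cone0.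
have par y : cone y -> cone (z - y) -> y = (tm y / tm z) *: z.
  move=> cy czy; have := @null_cone_eq0 y (z - y) cy czy.
  rewrite addrC subrK => /(_ qz)[qy qzy _].
  by apply: null_parallel.
rewrite (par u) // (par w) // -!scalerBl.
case/orP: (le_total (tm u / tm z) (tm w / tm z)) => h; apply/orP; [right|left];
  by apply: coneZ; rewrite ?subr_ge0.
Qed.

(* Two points displaced from the midpoint of a timelike segment in opposite
   spacelike directions are incomparable. *)
Lemma timelike_not_chain z : (0 < n)%N -> cone z -> mq z z < 0 ->
  exists u w, [/\ cone u, cone (z - u), cone w, cone (z - w) &
    0 < mq (u - w) (u - w)].
Proof.
move=> n0 /coneP[_ tz] qz.
have nd : ord0 != ord_max :> 'I_n.+1 by rewrite -val_eqE /= eq_sym -lt0n.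
pose e := evec ord0; have qe : mq e e = 1 by rewrite mq_evec eqxx eta_sp.
have te : tm e = 0 by rewrite /tm evecE eq_sym (negPf nd).
(* With the [s] below, [mq z z / 4 = - s * (D / 2)], where [D / 2] is the sum of [|c|] and
   [1 - mq z z]. The first absorbs the cross term, at most [s * |c|], and the second absorbs
   [s * s], since [s <= 1 - mq z z]. *)
pose c := mq z e; pose D := 2 * (1 + `|c| - mq z z).
have c1 := ler_norm c; have c2 := ler_norm (- c); rewrite normrN in c2.
have D2 : 2 <= D by rewrite /D; have := normr_ge0 c; lra.
have D0 : 0 < D by lra.
pose s := - mq z z / (2 * D).
have s0 : 0 < s by apply: divr_gt0; lra.
have sD : s * (2 * D) = - mq z z by rewrite /s divfK //; lra.
have key a : (a = s \/ a = - s) -> cone (2^-1 *: z + a *: e).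
  move=> ha; apply/coneP; split; last first.
    by rewrite tmD !tmZ te; lra.
  rewrite /mq !mq_lin -!/(mq _ _) (mqC e z) -/c qe.
  have : s * s <= s * (D / 2).
    apply: ler_wpM2l; first lra.
    rewrite /s ler_pdivrMr; last lra.
    have : 2 * 2 <= D * D by apply: ler_pM; lra.
    rewrite /D; have := normr_ge0 c; nra.
  have : s * c <= s * `|c| by rewrite ler_wpM2l //; lra.
  have : s * - c <= s * `|c| by rewrite ler_wpM2l //; lra.
  case: ha => ->; rewrite /D in sD *; nra.
exists (2^-1 *: z + s *: e), (2^-1 *: z - s *: e).
have e1 a : z - (2^-1 *: z + a *: e) = 2^-1 *: z + (- a) *: e.
  by rewrite opprD addrA -{1}(scale1r z) -scalerBl scaleNr; congr (_ *: _ + _); lra.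
rewrite -scaleNr !e1 opprK; split; try by apply: key; auto.
have -> : 2^-1 *: z + s *: e - (2^-1 *: z + - s *: e) = (2 * s) *: e.
  by rewrite opprD addrACA subrr add0r scaleNr opprK -scalerDl; congr (_ *: _); ring.
by rewrite /mq !mq_lin -/(mq _ _) qe mulr1; nra.
Qed.

(** A common point exists already in the span of [a] and [b]: as both are null, each equation
    determines the coefficient of the other vector. *)
Lemma null_planes_meet a b p r : mq a a = 0 -> mq b b = 0 -> mq a b != 0 ->
  exists x, mq (x - p) a = 0 /\ mq (x - r) b = 0.
Proof.
move=> qa qb ab.
exists ((mq r b / mq a b) *: a + (mq p a / mq a b) *: b).
rewrite /mq !mq_lin -!/(mq _ _) qa qb (mqC b a) !divfK //; split; ring.
Qed.

(** * Bijections that preserve the cone *)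

Section CausalBijection.
Variables (f g : W -> W).
Hypotheses (n0 : (0 < n)%N) (fK : cancel f g) (gK : cancel g f).
Hypothesis f_cone : forall x y, cone (y - x) = cone (f y - f x).

(* A null pair is characterised by its causal interval being a chain. *)
Lemma causal_null x v : mq v v = 0 -> mq (f (x + v) - f x) (f (x + v) - f x) = 0.
Proof.
wlog cv : x v / cone v => [H|] qv.
  have /orP[cv|cv] : cone v || cone (- v) by apply: cone_total; rewrite qv.
    exact: H.
  have := H (x + v) (- v) cv; rewrite addrK mqNN => /(_ qv).
  by rewrite -(opprB (f (x + v))) mqNN.
have cfv : cone (f (x + v) - f x) by rewrite -f_cone addrAC subrr add0r.
apply/eqP; rewrite eq_le; have /coneP[-> _] := cfv; rewrite leNgt /=.
apply/negP => /(timelike_not_chain n0 cfv)[u [w [cu czu cw czw]]].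
have g_cone y z : cone (g z - g y) = cone (z - y) by rewrite f_cone !gK.
(* [y t] is the displacement from [x] of the preimage of [f x + t]. For [u] and [w] these lie in the
   causal interval of the null vector [v], hence are comparable, and then so are [u] and [w], which
   are spacelike separated. *)
pose y t := g (f x + t) - x.
have h1 t : cone t -> cone (y t).
  by move=> ct; rewrite f_cone gK addrAC subrr add0r.
have h2 t : cone (f (x + v) - f x - t) -> cone (v - y t).
  have -> : v - y t = (x + v) - g (f x + t) by rewrite /y opprB addrA (addrC v).
  by move=> ct; rewrite f_cone gK opprD addrA.
have := cone_chain_null cv qv (h1 _ cu) (h2 _ czu) (h1 _ cw) (h2 _ czw).
have yB s t : cone (y s - y t) = cone (s - t).
  by rewrite /y opprB addrA subrK g_cone opprD addrACA subrr add0r.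
rewrite !yB.
rewrite -(opprB u w) => /cone_le0; lra.
Qed.

(** The images of the two displacements are null, and so is their difference, which is again the
    image of a displacement along [v]; null vectors with null difference are parallel. *)
Lemma causal_null_line x v t : mq v v = 0 -> v != 0 ->
  exists s, f (x + t *: v) - f x = s *: (f (x + v) - f x).
Proof.
move=> qv v0; set a := f (x + v) - f x; set b := f (x + t *: v) - f x.
have qa : mq a a = 0 by apply: causal_null.
have qb : mq b b = 0 by apply: causal_null; rewrite /mq !mq_lin -/(mq _ _) qv !mulr0.
have a0 : a != 0.
  apply: contraNneq v0 => /eqP; rewrite subr_eq0 => /eqP/(can_inj fK)/eqP.
  by rewrite -subr_eq0 addrAC subrr add0r.
exists (tm b / tm a); apply: null_parallel => //.
have -> : a - b = f ((x + t *: v) + (1 - t) *: v) - f (x + t *: v).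
  by rewrite -(addrA x) -scalerDl (addrC t) subrK scale1r /a /b opprB subrKA.
by apply: causal_null; rewrite /mq !mq_lin -/(mq _ _) qv !mulr0.
Qed.

End CausalBijection.

(* The null hyperplane through [p] with normal [v] consists of the null line
   [p + R v] and of the points unrelated to this line, so [f] maps null
   hyperplanes to null hyperplanes; parallel ones stay disjoint, hence parallel. *)
Lemma causal_null_direction (f g : W -> W) (n0 : (0 < n)%N) (fK : cancel f g) (gK : cancel g f)
    (f_cone : forall x y, cone (y - x) = cone (f y - f x)) v :
  mq v v = 0 -> v != 0 -> exists2 w, w != 0 &
  forall x t, exists s, f (x + t *: v) - f x = s *: w.
Proof.
move=> qv v0.
have g_cone x y : cone (y - x) = cone (g y - g x) by rewrite [RHS]f_cone !gK.
have cmp x y : (mq (y - x) (y - x) <= 0) = (mq (f y - f x) (f y - f x) <= 0).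
  have E z : (mq z z <= 0) = cone z || cone (- z).
    by apply/idP/idP; [exact: cone_total | exact: cone_le0].
  by rewrite !E !opprB (f_cone x y) (f_cone y x).
have [dir dirE] : exists dir : W -> W, forall x, f (x + v) - f x = dir x by eexists.
have qd x : mq (dir x) (dir x) = 0 by rewrite -dirE; apply: causal_null gK f_cone _ _ _.
have d0 x : dir x != 0.
  rewrite -dirE; apply: contraNneq v0 => /eqP; rewrite subr_eq0 => /eqP/(can_inj fK)/eqP.
  by rewrite -subr_eq0 addrAC subrr add0r.
have plane p y : mq (f y - f p) (dir p) = 0 -> mq (y - p) v = 0.
  move=> h; apply/eqP; apply: contraT => nz.
  (* As [v] is null, the square of [y - p - t *: v] is affine in [t]; this is its root, a point of
     the line on the light cone of [y]. *)
  pose t := (mq (y - p) (y - p)) / (2 * mq (y - p) v).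
  have : mq (y - (p + t *: v)) (y - (p + t *: v)) <= 0.
    rewrite opprD addrA; move: (y - p) nz @t => z nz t.
    have E : t * (2 * mq z v) = mq z z by rewrite /t divfK // mulf_neq0 // pnatr_eq0.
    rewrite /mq !mq_lin -!/(mq _ _) qv (mqC v); lra.
  (* Subtracting a multiple of [dir p] does not change the square of [f y - f p], which is
     orthogonal to it. So [f y - f p] is causal, hence a multiple of [dir p], and [g] carries [y]
     back onto the line through [p]. *)
  have [s fs] := causal_null_line n0 fK gK f_cone p t qv v0.
  rewrite cmp -[f (p + _)](subrK (f p)) fs (addrC _ (f p)) opprD addrA dirE.
  have [d dE] : exists d, d = f y - f p by eexists.
  rewrite -dE in h *.
  rewrite {1}/mq !mq_lin -!/(mq _ _) qd (mqC (dir p)) h => hd.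
  have dp : d = (tm d / tm (dir p)) *: dir p.
    apply: orth_null_parallel => //; lra.
  have [s' gs] := causal_null_line n0 gK fK g_cone (f p) (tm d / tm (dir p)) (qd p) (d0 p).
  move: gs; rewrite -dp -dirE dE ![f p + _]addrC !subrK !fK addrAC subrr add0r => ys.
  by move: nz; rewrite ys /mq !mq_lin -/(mq _ _) qv mulr0 eqxx.
(* Otherwise the image hyperplanes meet, and the preimage of a common point lies in both hyperplanes
   with normal [v] through [p] and [r], which are distinct and parallel. *)
have par1 p r : mq (p - r) v != 0 -> mq (dir p) (dir r) = 0.
  move=> pr; apply/eqP; apply: contraT => nz.
  have [x [xp xr]] := null_planes_meet (f p) (f r) (qd p) (qd r) nz.
  rewrite -(gK x) in xp xr; move: pr; have -> : p - r = (g x - r) - (g x - p).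
    by rewrite opprB [RHS]addrC subrKA.
  by rewrite /mq bilDl bilNl -!/(mq _ _) (plane _ _ xp) (plane _ _ xr) subrr eqxx.
have par p r : mq (p - r) v != 0 -> dir p = (tm (dir p) / tm (dir r)) *: dir r.
  by move=> pr; apply: orth_null_parallel; rewrite ?qd // par1.
(* The time axis is transverse to every null hyperplane, so a point [p] in the hyperplane of the
   origin is compared with the origin through [p + e]. *)
pose e := evec (@ord_max n).
have ev : mq e v != 0.
  rewrite mq_evec_max oppr_eq0.
  by apply: tm_neq0; rewrite ?qv.
exists (dir 0) => // p t.
have [s ->] := causal_null_line n0 fK gK f_cone p t qv v0; rewrite dirE.
have [z|nz] := eqVneq (mq (p - 0) v) 0; last first.
  by have -> := par _ _ nz; rewrite scalerA; eexists.
have h1 : mq (p - (p + e)) v != 0 by rewrite opprD addrA subrr sub0r /mq bilNl oppr_eq0.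
have h2 : mq (p + e - 0) v != 0.
  by move: z; rewrite !subr0 /mq bilDl -!/(mq _ _) => ->; rewrite add0r.
by have -> := par _ _ h1; have -> := par _ _ h2; rewrite !scalerA; eexists.
Qed.

(* With [t = evec ord_max], the hypothesis for [i] puts [M t] in the span of [t]
   and [e_i]; using two different [i], [M t] is a multiple of [t] and then the
   eigenvalues of [t + e_i] and [t - e_i] agree. *)
Lemma null_eigen_scalar M : (1 < n)%N ->
  (forall i, i != ord_max -> exists a b,
     M *m (evec ord_max + evec i) = a *: (evec ord_max + evec i) /\
     M *m (evec ord_max - evec i) = b *: (evec ord_max - evec i)) ->
  exists m, M = m%:M.
Proof.
move=> n1 H.
(* Half the sum and half the difference of the two eigenvector equations. *)
have entry i : i != ord_max -> exists c d, forall k,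
    M k ord_max = c * (k == ord_max)%:R + d * (k == i)%:R /\
    M k i = d * (k == ord_max)%:R + c * (k == i)%:R.
  move=> /H[a [b [ha hb]]]; exists ((a + b) / 2), ((a - b) / 2) => k.
  have := congr1 (fun u : W => u k 0) ha; have := congr1 (fun u : W => u k 0) hb.
  rewrite !mulmxDr mulmxN /evec -!colE !mxE !eqxx !andbT => e1 e2.
  split; lra.
have offd i : i != ord_max -> M i ord_max = 0.
  move=> ni; have [j nji nj] : exists2 j : 'I_n.+1, j != i & j != ord_max.
    (* One of the indices 0 and 1 differs from [i], and both are spatial since [n] is at least 2. *)
    pose k := if i == ord0 then 1%N else 0%N.
    have kn : (k < n.+1)%N by rewrite /k; case: ifP => _ //; rewrite ltnS ltnW.
    exists (Ordinal kn); rewrite -val_eqE /= /k.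
      by case: ifPn => [/eqP-> //|]; rewrite eq_sym.
    by case: ifP => _; rewrite neq_ltn ?n1 // (ltn_trans _ n1).
  have [c [d /(_ i)[-> _]]] := entry _ nj.
  by rewrite (negPf ni) eq_sym (negPf nji) !mulr0 addr0.
exists (M ord_max ord_max); apply/matrixP => i j; rewrite mxE.
have [->|nj] := eqVneq j ord_max.
  have [->|ni] := eqVneq i ord_max; first by rewrite mulr1n.
  by rewrite offd.
have [c [d h]] := entry _ nj.
have [hj _] := h j; have [_ ->] := h i; have [-> _] := h ord_max.
move: hj; rewrite offd // !eqxx [ord_max == j]eq_sym !(negPf nj) => hj.
have -> : d = 0 by move: hj; rewrite /=; lra.
by rewrite !mul0r add0r addr0 mulr1 mulr_natr.
Qed.

(** * Similarities of the Minkowski form *)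

(** Passes between the conditions on rows and on columns, that is, between the inverse metric and
    the metric. The hypothesis makes [etam *m A^T *m etam] equal to [l] times the inverse of [A],
    which commutes with [A]. *)
Lemma similarity_tr A B l : A *m B = 1%:M ->
  A *m etam *m A^T = l *: etam -> A^T *m etam *m A = l *: etam.
Proof.
move=> AB h; have BA := mulmx1C AB.
have e1 : etam *m A^T = l *: (B *m etam) by rewrite scalemxAr -h !mulmxA BA mul1mx.
have e2 : etam *m A^T *m etam *m A = l%:M.
  by rewrite e1 -!scalemxAl -[B *m _ *m _]mulmxA etamK mulmx1 BA scalemx1.
have -> : A^T *m etam *m A = etam *m (etam *m A^T *m etam *m A).
  by rewrite !mulmxA etamK mul1mx.
by rewrite e2 mul_mx_scalar.
Qed.

Lemma similarity_inv A B l : A *m B = 1%:M ->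
  A^T *m etam *m A = l *: etam -> l != 0 /\ B^T *m etam *m B = l^-1 *: etam.
Proof.
move=> AB h.
have e : etam = l *: (B^T *m etam *m B).
  rewrite scalemxAl scalemxAr -h !mulmxA -trmx_mul AB trmx1 mul1mx -!mulmxA AB.
  by rewrite mulmx1.
have l0 : l != 0.
  apply/eqP => l0; have := congr1 (fun S : 'M[R]_n.+1 => S ord_max ord_max) e.
  by rewrite l0 scale0r etamE eqxx eta_max mxE => /eqP; rewrite oppr_eq0 oner_eq0.
by split=> //; rewrite [in RHS]e scalerA mulVf // scale1r.
Qed.

Lemma mq_similarity A l u v : A^T *m etam *m A = l *: etam ->
  mq (A *m u) (A *m v) = l * mq u v.
Proof. by move=> h; rewrite /mq bil_mul h bil_scale. Qed.

(** A negative factor would send two orthogonal spatial axes to two orthogonal timelike vectors;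
    their combination with time zero would then have negative square. *)
Lemma similarity_gt0 A B l : (1 < n)%N -> A *m B = 1%:M ->
  A^T *m etam *m A = l *: etam -> 0 < l.
Proof.
move=> n1 AB h; have [l0 _] := similarity_inv AB h.
rewrite lt_def l0 /= leNgt; apply/negP => ln.
pose i0 : 'I_n.+1 := ord0; pose i1 : 'I_n.+1 := @Ordinal n.+1 1 (leqW n1).
have m0 : i0 != ord_max by rewrite -val_eqE /= eq_sym -lt0n ltnW.
have m1 : i1 != ord_max by rewrite -val_eqE /= neq_ltn n1.
pose u := A *m evec i0; pose w := A *m evec i1.
have qu : mq u u = l by rewrite (mq_similarity _ _ h) mq_evec eqxx eta_sp ?mulr1.
have qw : mq w w = l by rewrite (mq_similarity _ _ h) mq_evec eqxx eta_sp ?mulr1.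
have uw : mq u w = 0 by rewrite (mq_similarity _ _ h) mq_evec mulr0.
have tu : tm u != 0.
  apply: tm_neq0; rewrite ?qu ?ltW //; apply: contraTneq ln => u0.
  by rewrite -qu u0 /mq bil0l ltxx.
have [|ge _] := @mq_rest (tm w *: u - tm u *: w).
  by rewrite tmB !tmZ; ring.
move: ge; rewrite /mq !mq_lin -!/(mq _ _) (mqC w u) qu qw uw => ge.
have := sqr_ge0 (tm w); have : 0 < tm u ^+ 2 by rewrite exprn_even_gt0.
nra.
Qed.

(** The image of the time axis is in the cone. If a cone vector [d] had its image in the opposite
    cone, pairing the two images would give [tm d <= 0], so [d] would be zero. The converse follows
    by antisymmetry of the cone. *)
Lemma cone_similarity A B l : A *m B = 1%:M -> A^T *m etam *m A = l *: etam ->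
  0 < l -> 0 <= A ord_max ord_max -> forall d, cone (A *m d) = cone d.
Proof.
move=> AB h l0 att; have BA := mulmx1C AB.
pose e := evec (@ord_max n).
have te := mq_evec_max.
have ce : cone (A *m e).
  apply/coneP; split; last by rewrite /tm /e /evec -colE mxE.
  by rewrite (mq_similarity _ _ h) te /tm evecE eqxx mulrN1; lra.
have imp d : cone d -> cone (A *m d).
  move=> cd; have /coneP[qd td] := cd.
  have q1 : mq (A *m d) (A *m d) <= 0 by rewrite (mq_similarity _ _ h) pmulr_rle0.
  have /orP[//|cn] := cone_total q1.
  have := cone_mq_le0 ce cn; rewrite /mq bilNr -/(mq _ _) (mq_similarity _ _ h) te.
  rewrite mulrN opprK pmulr_rle0 // => td'.
  have [->|d0] := eqVneq d 0; first by rewrite mulmx0 cone0.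
  have := tm_neq0 qd d0; have -> : tm d = 0 by lra.
  by rewrite eqxx.
move=> d; apply/idP/idP => [cA|]; last exact: imp.
have qd : mq d d <= 0.
  by have /coneP[+ _] := cA; rewrite (mq_similarity _ _ h) pmulr_rle0.
have /orP[//|/imp] := cone_total qd; rewrite mulmxN => cn.
have := congr1 (mulmx B) (cone_antisym cA cn).
by rewrite mulmxA BA mul1mx mulmx0 => ->; exact: cone0.
Qed.

(* The first-kind Christoffel symbols of the metric [l * eta], where [L] is the
   gradient of [l]; the vanishing trace is harmonicity of the coordinates. *)
Lemma conformal_harmonic_vanish (Gam : 'I_n.+1 -> 'I_n.+1 -> 'I_n.+1 -> R)
    (L : 'I_n.+1 -> R) : (1 < n)%N ->
  (forall a b c, Gam a b c = Gam b a c) ->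
  (forall a b c, Gam a c b + Gam b c a = etam a b * L c) ->
  (forall c, \sum_a eta a * Gam a a c = 0) ->
  forall a b c, Gam a b c = 0.
Proof.
move=> n1 sym E tr.
have L0 c : L c = 0.
  have diag a : Gam a c a = eta a * L c / 2.
    by have := E a a c; rewrite etamE eqxx mulr1n; lra.
  have off a : a != c -> eta a * Gam a a c = - (L c / 2).
    move=> ac; have := E a c a; rewrite etamE (negPf ac) mulr0n mul0r (sym c a a) diag.
    move=> e; have -> : Gam a a c = - (eta a * L c / 2) by lra.
    by rewrite mulrN !mulrA eta_sqr mul1r.
  have := tr c; rewrite (bigD1 c) //= diag !mulrA eta_sqr mul1r.
  rewrite (eq_bigr (fun=> - (L c / 2))) => [|a]; last exact: off.
  rewrite sumr_const; set m := #|_|.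
  (* Of the [n.+1] indices, [n] differ from [c]; the trace is therefore [(1 - n)] times
     [L c / 2]. *)
  have -> : m = n by rewrite /m cardC1 card_ord.
  have : 2%:R <= n%:R :> R by rewrite ler_nat.
  rewrite -mulr_natr => h2 h3.
  have : L c * (1 - n%:R) = 0 by lra.
  by move/eqP; rewrite mulf_eq0 => /orP[/eqP//|/eqP h]; lra.
(* With [L = 0], [Gam] is symmetric in its first two indices and antisymmetric in the first and
   third. Alternating the two exchanges gives [Gam = - Gam], as for the uniqueness of the
   Levi-Civita connection. *)
move=> a b c; have {}E p q r : Gam p r q = - Gam q r p.
  by apply/eqP; rewrite -subr_eq0 opprK E L0 mulr0.
have := E a c b; have := E b a c; have := E c b a.
by rewrite (sym c b) (sym c a) (sym b a); lra.
Qed.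

End MinkowskiAlgebra.

(** * Causal automorphisms are affine *)

Section Minkowski.
Local Open Scope ring_scope.
Variable n : nat.
Local Notation P := (Pt n).
Local Notation W := 'cV[R]_n.+1.
Local Notation smooth := (Defs.smooth n).
Local Notation smooth_map := (Defs.smooth_map n).
Implicit Types (f g phi : P -> R) (x y p q : P) (F G : P -> P) (i j k : 'I_n.+1) (u v w : W).

(** * Points as column vectors *)

Definition vec x : W := \col_i x i.
Definition unvec v : P := fun i => v i 0.

Lemma vecK : cancel vec unvec.
Proof. by move=> x; apply: functional_extensionality => i; rewrite /unvec mxE. Qed.
Lemma unvecK : cancel unvec vec.
Proof. by move=> v; apply/colP => i; rewrite mxE. Qed.

Lemma sum_spatial (h : 'I_n.+1 -> R) :
  \big[Rplus/IZR 0]_(i < n.+1 | ltn (nat_of_ord i) n) h i - h ord_max = \sum_i eta R i * h i.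
Proof.
rewrite [RHS](bigD1 ord_max) //= eta_max mulN1r [RHS]addrC; congr (_ - _).
have lt_max i : ltn i n = (i != ord_max).
  by rewrite -val_eqE /= ltn_neqAle -ltnS ltn_ord andbT.
transitivity (\sum_(i < n.+1 | i != ord_max) h i); first exact: eq_bigl.
by apply: eq_bigr => i ni; rewrite eta_sp // mul1r.
Qed.

Lemma mink_mq x y : mink n x y = mq (vec x) (vec y).
Proof.
rewrite mqE; apply: etrans (sum_spatial (fun i => x i * y i)) _.
by apply: eq_bigr => i _; rewrite !mxE.
Qed.

(** The closed cone contains zero, and a nonzero causal vector has nonzero time, so the weak sign
    condition becomes strict. *)
Lemma causal_le_cone p q : causal_le n p q <-> cone (vec q - vec p).
Proof.
have E : vec (vsub n q p) = vec q - vec p by apply/colP => i; rewrite !mxE.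
rewrite -E /causal_le /future_causal /causal_vec; set d := vsub n q p.
have Z : vec (vzero n) = 0 by apply/colP => i; rewrite !mxE.
have tmd : tm (vec d) = d ord_max by rewrite /tm mxE.
split=> [[->|[[d0 /RleP qd] /RltP td]]|/coneP[qd td]].
- by rewrite Z cone0.
- by apply/coneP; rewrite -mink_mq tmd qd ltW.
case: (eqVneq (vec d) 0) => [e|nz].
  by left; rewrite -(vecK d) e -Z vecK.
right; split; last by apply/RltP; rewrite -tmd lt_def td tm_neq0.
split; last by apply/RleP; rewrite mink_mq.
by move=> e; rewrite e Z eqxx in nz.
Qed.

(** * Differentiation rules, the wave operator and Jacobians *)

Lemma smooth_const c : smooth (fun _ => c).
Proof. by move=> k; apply: Ck_const. Qed.
Lemma smooth_coord i : smooth (fun x => x i).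
Proof. by move=> k; apply: Ck_coord. Qed.
Lemma smooth_mul f g : smooth f -> smooth g -> smooth (fun x => f x * g x).
Proof. by move=> sf sg k; apply: Ck_mul. Qed.
Lemma smooth_sum m (f : 'I_m -> P -> R) : (forall j : 'I_m, smooth (f j)) ->
  smooth (fun x => \sum_j f j x).
Proof. by move=> sf k; apply: Ck_sum => j; apply: sf. Qed.

Lemma pd_const c i x : pd (fun _ => c) i x = 0.
Proof. by apply: is_partial_pd; apply: derivable_pt_lim_const. Qed.
Lemma pd_coord i j x : pd (fun x => x j) i x = (j == i)%:R.
Proof. by rewrite (is_partial_pd (is_partial_coord i j x)); case: ifP. Qed.
Lemma pd_add f g i x : smooth f -> smooth g ->
  pd (fun x => f x + g x) i x = pd f i x + pd g i x.
Proof.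
by move=> sf sg; apply: is_partial_pd; apply: is_partial_add; apply: smooth_partial.
Qed.
Lemma pd_mul f g i x : smooth f -> smooth g ->
  pd (fun x => f x * g x) i x = pd f i x * g x + f x * pd g i x.
Proof.
by move=> sf sg; apply: is_partial_pd; apply: is_partial_mul; apply: smooth_partial.
Qed.
Lemma pd_scale c f i x : smooth f -> pd (fun x => c * f x) i x = c * pd f i x.
Proof.
by move=> sf; rewrite pd_mul ?pd_const ?mul0r ?add0r //; apply: smooth_const.
Qed.
Lemma smooth_scale c f : smooth f -> smooth (fun x => c * f x).
Proof. by move=> sf; apply: smooth_mul => //; apply: smooth_const. Qed.
Lemma pd_sum m (f : 'I_m -> P -> R) i x : (forall j : 'I_m, smooth (f j)) ->
  pd (fun x => \sum_j f j x) i x = \sum_j pd (f j) i x.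
Proof.
move=> sf; apply: is_partial_pd; apply: derivable_pt_lim_sum => j.
exact: smooth_partial.
Qed.

Lemma pd_comp phi G i x : smooth phi -> smooth_map G ->
  pd (fun y => phi (G y)) i x = \sum_j pd phi j (G x) * pd (fun y => G y j) i x.
Proof. by move=> sphi sG; apply: is_partial_pd; apply: is_partial_comp. Qed.

Definition box f x : R := \sum_i eta R i * pd (pd f i) i x.

Lemma wave_zeroP f : smooth f -> wave_zero n f <-> forall x, box f x = 0.
Proof.
move=> sf; split=> [[d1 [d2 [h1 [h2 h3]]]] x|h].
  rewrite -[RHS](h3 x); apply: etrans (esym (sum_spatial (fun i => d2 i x))).
  apply: eq_bigr => i _.
  have -> : pd f i = d1 i by apply: functional_extensionality => y; apply: is_partial_pd.
  by rewrite (is_partial_pd (h2 i x)).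
exists (fun i x => pd f i x), (fun i x => pd (pd f i) i x); split=> [i x|].
  exact: smooth_partial.
split=> [i x|x]; first by apply/smooth_partial/smooth_pd.
by apply: etrans (sum_spatial (fun i => pd (pd f i) i x)) (h x).
Qed.

(** If [g] solves the wave equation, its square does so exactly when the gradient of [g] is null;
    the wave equation thus detects the null cone. *)
Lemma box_square g x : smooth g ->
  box (fun x => g x * g x) x = 2 * (\sum_i eta R i * (pd g i x * pd g i x)) + 2 * (g x * box g x).
Proof.
move=> sg; rewrite /box !mulr_sumr -big_split; apply: eq_bigr => i _ /=.
have spg : smooth (pd g i) by apply: smooth_pd.
have -> : pd (fun x => g x * g x) i = fun x => pd g i x * g x + g x * pd g i x.
  by apply: functional_extensionality => y; rewrite pd_mul.
rewrite pd_add ?pd_mul //; try exact: smooth_mul.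
by ring.
Qed.

Definition jac F x : 'M[R]_n.+1 := \matrix_(i, j) pd (fun z => F z i) j x.

Lemma jac_comp F G x : smooth_map F -> smooth_map G ->
  jac (fun y => F (G y)) x = jac F (G x) *m jac G x.
Proof.
move=> sF sG; apply/matrixP => i j; rewrite !mxE.
rewrite (pd_comp j x (sF i) sG); apply: eq_bigr => k _; by rewrite !mxE.
Qed.

Lemma jac_cancel F G x : smooth_map F -> smooth_map G -> cancel G F ->
  jac F (G x) *m jac G x = 1%:M.
Proof.
move=> sF sG GK; rewrite -jac_comp //; apply/matrixP => i j; rewrite !mxE.
have -> : (fun y => F (G y) i) = fun y => y i.
  by apply: functional_extensionality => y; rewrite GK.
exact: pd_coord.
Qed.

Lemma jac_const_affine F (A : 'M[R]_n.+1) : smooth_map F -> (forall x, jac F x = A) ->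
  forall x y, vec (F y) - vec (F x) = A *m (vec y - vec x).
Proof.
move=> sF H x y; apply/colP => i; rewrite !mxE.
have D j z : Defs.is_partial n (fun z => F z i) j z (A i j).
  by have := smooth_partial j z (sF i); rewrite -(H z) mxE.
rewrite (constant_partials_affine x y D) addrC addKr.
by apply: eq_bigr => j _; rewrite !mxE.
Qed.

Lemma line_derivative F i x v : smooth_map F ->
  derivable_pt_lim (fun t => F (unvec (vec x + t *: v)) i) 0 ((jac F x *m v) i 0).
Proof.
move=> sF; pose c t := unvec (vec x + t *: v).
have c0 : c 0 = x by rewrite /c scale0r addr0 vecK.
have -> : (jac F x *m v) i 0 = \sum_j pd (fun z => F z i) j (c 0) * v j 0.
  by rewrite c0 mxE; apply: eq_bigr => j _; rewrite mxE.
apply: (@smooth_chain n (fun z => F z i) c 0 (fun j => v j 0) (sF i)) => j.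
apply/is_derive_Reals.
have -> : (fun s => c s j) = (fun s => Rplus (x j) (Rmult s (v j 0))).
  by apply: functional_extensionality => s; rewrite /c /unvec !mxE.
by auto_derive => //; rewrite Rmult_1_l.
Qed.

Section CausalAutomorphism.
Variables (F G : P -> P).
Hypotheses (n1 : (1 < n)%N) (FK : cancel F G) (GK : cancel G F).
Hypotheses (sF : smooth_map F) (sG : smooth_map G).
Hypothesis F_causal : forall p q, causal_le n p q <-> causal_le n (F p) (F q).

Let f v := vec (F (unvec v)).
Let g v := vec (G (unvec v)).

Let fK : cancel f g.
Proof. by move=> v; rewrite /g /f vecK FK unvecK. Qed.
Let gK : cancel g f.
Proof. by move=> v; rewrite /g /f vecK GK unvecK. Qed.
Let f_cone u v : cone (v - u) = cone (f v - f u).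
Proof.
have /(_ (unvec u) (unvec v)) [h1 h2] := F_causal; rewrite /f.
apply/idP/idP => [c|/causal_le_cone/h2/causal_le_cone]; last by rewrite !unvecK.
by apply/causal_le_cone/h1/causal_le_cone; rewrite !unvecK.
Qed.

Lemma jac_inv_F x : jac F x *m jac G (F x) = 1%:M.
Proof. by rewrite -{1}(FK x); apply: jac_cancel. Qed.

(** [F] moves every line of direction [v] along one fixed [w], so the Jacobians at [x] and [x0] both
    send [v] to multiples of [w], the one at [x0] being nonzero. *)
Lemma jac_null_eigen x x0 v : mq v v = 0 -> v != 0 ->
  exists a, (jac G (F x0) *m jac F x) *m v = a *: v.
Proof.
move=> qv v0.
have [w w0 hw] := causal_null_direction (ltnW n1) fK gK f_cone qv v0.
have [k wk] : exists k, w k 0 != 0.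
  apply/existsP; apply: contraNT w0 => /existsPn h; apply/eqP/colP => k.
  by rewrite mxE; apply/eqP; have := h k; rewrite negbK.
(* The parameter [s] along [w] is not known to depend differentiably on [t]. It is eliminated:
   [w k 0 * F j - w j 0 * F k] is constant on the line, so its derivative vanishes. *)
have par y : jac F y *m v = ((jac F y *m v) k 0 / w k 0) *: w.
  apply/colP => j; rewrite [RHS]mxE mulrAC; apply: (canRL (mulfK wk)).
  have D i := line_derivative i y v sF.
  have D1 := derivable_pt_lim_scal _ (w k 0) _ _ (D j).
  have D2 := derivable_pt_lim_scal _ (w j 0) _ _ (D k).
  have := derivable_pt_lim_minus _ _ _ _ _ D1 D2.
  set h := (X in derivable_pt_lim X) => Dh.
  have hc t : h t = w k 0 * F y j - w j 0 * F y k.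
    have [s] := hw (vec y) t; rewrite /f vecK => e.
    have ej := congr1 (fun u : W => u j 0) e; have ek := congr1 (fun u : W => u k 0) e.
    rewrite !mxE in ej ek.
    rewrite /h /mult_real_fct /minus_fct !RealsE.
    have -> : F (unvec (vec y + t *: v)) j = F y j + s * w j 0 by rewrite -ej [RHS]addrC subrK.
    have -> : F (unvec (vec y + t *: v)) k = F y k + s * w k 0 by rewrite -ek [RHS]addrC subrK.
    by ring.
  have Dc : derivable_pt_lim h 0 0.
    have -> : h = (fun _ => w k 0 * F y j - w j 0 * F y k).
      by apply: functional_extensionality.
    exact: derivable_pt_lim_const.
  have := uniqueness_limite _ _ _ _ Dh Dc; rewrite !RealsE => e.
  apply/eqP; rewrite -subr_eq0 -e; apply/eqP; ring.
set b := jac F x0 *m v; have bw := par x0; set c0 := _ / _ in bw.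
have c00 : c0 != 0.
  apply: contraNneq v0 => z; rewrite z scale0r in bw.
  by rewrite -[v]mul1mx -(mulmx1C (jac_inv_F x0)) -mulmxA bw mulmx0.
have wE : w = c0^-1 *: (jac F x0 *m v) by rewrite bw scalerA mulVf // scale1r.
have parx := par x; set cx := _ / _ in parx; exists (cx / c0).
rewrite -mulmxA parx wE -!scalemxAr mulmxA (mulmx1C (jac_inv_F x0)) mul1mx.
by rewrite scalerA.
Qed.

Lemma jac_conformal x x0 : exists m, jac F x = m *: jac F x0.
Proof.
have [|m hm] := @null_eigen_scalar _ _ (jac G (F x0) *m jac F x) n1.
  move=> i ni; set t := evec R ord_max; set e := evec R i.
  have te : mq t e = 0 by rewrite mq_evec eq_sym (negPf ni).
  have tt : mq t t = -1 by rewrite mq_evec eqxx eta_max.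
  have ee : mq e e = 1 by rewrite mq_evec eqxx eta_sp.
  have neq (s : R) : t + s *: e != 0.
    apply/eqP => /(congr1 (mq t)); rewrite /mq !mq_lin bil0r -!/(mq _ _) te tt.
    by lra.
  have null (s : R) : s * s = 1 -> mq (t + s *: e) (t + s *: e) = 0.
    by move=> ss; rewrite /mq !mq_lin -!/(mq _ _) (mqC e t) te tt ee; lra.
  have [|a ha] := @jac_null_eigen x x0 (t + 1 *: e) _ (neq _); first by apply: null; ring.
  have [|b hb] := @jac_null_eigen x x0 (t + -1 *: e) _ (neq _); first by apply: null; ring.
  by exists a, b; rewrite scale1r in ha; rewrite scaleN1r in hb.
exists m; rewrite -[LHS]mul1mx -(jac_inv_F x0) -mulmxA hm mul_mx_scalar //.
Qed.

(* The components [h l] of [(DF x0)^-1 o F] have gradient [mu e_l] with the same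
   [mu] for all [l], so [d_i mu = d_i d_l h_l = d_l d_i h_l = 0] for [l <> i]. *)
Lemma jac_constant x x0 : jac F x = jac F x0.
Proof.
pose N := jac G (F x0).
have NE y : exists m, N *m jac F y = m%:M.
  have [m ->] := jac_conformal y x0; exists m.
  by rewrite -scalemxAr (mulmx1C (jac_inv_F x0)) scalemx1.
pose h l y := \sum_k N l k * F y k.
have sh l : smooth (h l) by apply: smooth_sum => k; apply: smooth_scale; apply: sF.
have pdh l j y : pd (h l) j y = (N *m jac F y) l j.
  rewrite pd_sum; last by move=> k; apply: smooth_scale; apply: sF.
  by rewrite mxE; apply: eq_bigr => k _; rewrite pd_scale ?mxE //; apply: sF.
pose mu y := (N *m jac F y) ord_max ord_max.
have muE y : N *m jac F y = (mu y)%:M.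
  by rewrite /mu; have [m ->] := NE y; rewrite mxE eqxx.
have mul l : pd (h l) l = mu.
  by apply: functional_extensionality => y; rewrite pdh muE mxE eqxx.
have smu : smooth mu by rewrite -(mul ord0); apply: smooth_pd.
have dmu i y : pd mu i y = 0.
  have [l li] : exists l : 'I_n.+1, l != i.
    have [->|ni] := eqVneq i ord0; last by exists ord0; rewrite eq_sym.
    by exists ord_max; rewrite -val_eqE /= -lt0n ltnW.
  rewrite -(mul l) pdC //.
  have -> : pd (h l) i = fun=> 0.
    by apply: functional_extensionality => z; rewrite pdh muE mxE (negPf li).
  exact: pd_const.
have muc : mu x = mu x0.
  have D i z : Defs.is_partial n mu i z 0.
    by have := smooth_partial i z smu; rewrite dmu.
  rewrite (constant_partials_affine x0 x D) big1 ?addr0 //.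
    by rewrite RealsE addr0.
  by move=> i _; rewrite RealsE mul0r.
by rewrite -[LHS]mul1mx -[RHS]mul1mx -(jac_inv_F x0) -!mulmxA -/N !muE muc.
Qed.

(** [F] is affine with linear part [jac F x], which therefore maps null vectors to null vectors;
    [null_form] applies to the pulled-back form. *)
Lemma causal_similarity x : exists l, (jac F x)^T *m etam R n *m jac F x = l *: etam R n.
Proof.
eexists; apply: null_form; first by rewrite !trmx_mul trmxK etam_sym mulmxA.
move=> v qv; rewrite -bil_mul -/(mq _ _).
have aff := @jac_const_affine F (jac F x) sF (fun y => jac_constant y x) x (unvec (vec x + v)).
have := causal_null (ltnW n1) gK f_cone (vec x) qv.
by rewrite /f vecK aff unvecK addrAC subrr add0r.
Qed.

Lemma causal_time_derivative x : 0 <= jac F x ord_max ord_max.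
Proof.
have ce : cone (evec R (@ord_max n)).
  by apply/coneP; rewrite mq_evec_max /tm evecE eqxx oppr_le0 ler01.
have := f_cone (vec x) (vec x + evec R (@ord_max n)).
have aff := @jac_const_affine F (jac F x) sF (fun y => jac_constant y x) x
  (unvec (vec x + evec R (@ord_max n))).
rewrite {1}/f {1}/f vecK aff unvecK addrAC subrr add0r ce => /esym/coneP[_].
by rewrite /tm /evec -colE mxE.
Qed.

(** The Jacobian [B] of [G] is constant, so no first-order terms arise: the second derivatives of
    [phi] are contracted with [B *m etam *m B^T], a multiple of [etam]. *)
Lemma causal_box phi : smooth phi -> exists2 l, l != 0 &
  forall y, box (fun z => phi (G z)) y = l * box phi (G y).
Proof.
move=> sphi; pose y : P := fun=> 0; pose A := jac F (G y); pose B := jac G y.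
have AB : A *m B = 1%:M by apply: jac_cancel.
have BA := mulmx1C AB.
have GB z : jac G z = B.
  rewrite -[LHS]mul1mx -BA -mulmxA -[RHS]mulmx1; congr (_ *m _).
  by rewrite /A (jac_constant (G y) (G z)); apply: jac_cancel.
have [l hA] := causal_similarity (G y).
have [l0 hB] := similarity_inv AB hA.
have BAt : B^T *m A^T = 1%:M by rewrite -trmx_mul AB trmx1.
have hBt := similarity_tr (A := B^T) BAt.
rewrite trmxK in hBt; have {}hBt := hBt _ hB.
exists l^-1; first by rewrite invr_eq0.
move=> z; have spsi := smooth_comp sphi sG.
have pd1 i : pd (fun z => phi (G z)) i = fun z => \sum_j B j i * pd phi j (G z).
  apply: functional_extensionality => t; rewrite pd_comp //; apply: eq_bigr => j _.
  by rewrite mulrC -(GB t) mxE.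
have pd2 i : pd (pd (fun z => phi (G z)) i) i z =
    \sum_j \sum_k pd (pd phi j) k (G z) * (B j i * B k i).
  have sc j : smooth (fun z => pd phi j (G z)).
    by apply: smooth_comp => //; apply: smooth_pd.
  rewrite pd1 pd_sum => [|j]; last exact: smooth_scale.
  apply: eq_bigr => j _; rewrite pd_scale // pd_comp //; last exact: smooth_pd.
  rewrite mulr_sumr; apply: eq_bigr => k _.
  by rewrite -(GB z) !mxE; ring.
rewrite /box; under eq_bigr do rewrite pd2 mulr_sumr.
rewrite exchange_big mulr_sumr; apply: eq_bigr => j _ /=.
under eq_bigr do rewrite mulr_sumr.
rewrite exchange_big /=.
have ent k : \sum_i eta R i * (B j i * B k i) = l^-1 * (eta R j *+ (j == k)).
  have := congr1 (fun S : 'M[R]_n.+1 => S j k) hBt; rewrite [RHS]mxE etamE => <-.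
  rewrite mxE; apply: eq_bigr => i _; rewrite mul_mx_diag !mxE; ring.
rewrite (bigD1 j) //= [X in _ + X]big1 => [|k kj].
  rewrite addr0.
  transitivity (pd (pd phi j) j (G z) * \sum_i eta R i * (B j i * B j i)).
    by rewrite mulr_sumr; apply: eq_bigr => i _; ring.
  by rewrite ent eqxx mulr1n; ring.
transitivity (pd (pd phi j) k (G z) * \sum_i eta R i * (B j i * B k i)).
  by rewrite mulr_sumr; apply: eq_bigr => i _; ring.
by rewrite ent eq_sym (negPf kj) mulr0n; ring.
Qed.

End CausalAutomorphism.

End Minkowski.

(** * Maps preserving the wave equation *)

Section WavePreserving.
Local Open Scope ring_scope.
Variable n : nat.
Local Notation P := (Pt n).
Local Notation W := 'cV[R]_n.+1.
Local Notation smooth := (Defs.smooth n).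
Local Notation smooth_map := (Defs.smooth_map n).
Variables (F G : P -> P).
Implicit Types (f phi : P -> R) (x y p q : P) (i j k : 'I_n.+1) (u v w : W).
Hypotheses (n1 : (1 < n)%N) (FK : cancel F G) (GK : cancel G F).
Hypotheses (sF : smooth_map F) (sG : smooth_map G).
Hypothesis time_ge0 : forall x, 0 <= jac F x ord_max ord_max.
Hypothesis wave_comp : forall phi, smooth phi -> (forall x, box phi x = 0) ->
  forall y, box (fun z => phi (G z)) y = 0.

Let lin (a : W) x : R := \sum_k a k 0 * x k.

Let smooth_lin (a : W) : smooth (lin a).
Proof. by apply: smooth_sum => k; apply: smooth_scale; apply: smooth_coord. Qed.

Let pd_lin (a : W) i : pd (lin a) i = fun=> a i 0.
Proof.
apply: functional_extensionality => x; rewrite pd_sum; last first.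
  by move=> k; apply: smooth_scale; apply: smooth_coord.
rewrite (bigD1 i) //= big1 => [|k ki]; rewrite pd_scale ?pd_coord; try exact: smooth_coord.
  by rewrite eqxx mulr1 addr0.
by rewrite (negPf ki) mulr0.
Qed.

Let box_lin (a : W) x : box (lin a) x = 0.
Proof. by rewrite /box big1 // => i _; rewrite pd_lin pd_const mulr0. Qed.

Let jac_FG y : jac F (G y) *m jac G y = 1%:M.
Proof. exact: jac_cancel. Qed.

Lemma harmonic_components k y : box (fun z => G z k) y = 0.
Proof.
have := wave_comp (@smooth_coord n k) => -> // x.
rewrite /box big1 // => i _; have -> : pd (fun x : P => x k) i = fun=> (k == i)%:R.
  by apply: functional_extensionality => z; rewrite pd_coord.
by rewrite pd_const mulr0.
Qed.

(* Apply the hypothesis to [phi = (a . x)^2], which solves the wave equation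
   exactly when [a] is null. *)
Lemma gradient_conformal y : exists l, jac G y *m etam R n *m (jac G y)^T = l *: etam R n.
Proof.
eexists; apply: null_form; first by rewrite !trmx_mul trmxK etam_sym mulmxA.
move=> a qa.
have sq : smooth (fun x => lin a x * lin a x) by apply: smooth_mul.
have b0 x : box (fun x => lin a x * lin a x) x = 0.
  rewrite box_square // box_lin !mulr0 addr0.
  under eq_bigr do rewrite pd_lin.
  by rewrite -mqE qa mulr0.
have slG : smooth (fun z => lin a (G z)) by apply: smooth_comp.
have := wave_comp sq b0 y; rewrite (box_square y slG).
rewrite (wave_comp (smooth_lin a) (box_lin a)) !mulr0 addr0.
move/eqP; rewrite mulf_eq0 pnatr_eq0 /= => /eqP e.
rewrite -[RHS]e -[X in X *m _ *m _]trmxK -bil_mul -/(mq _ _) mqE.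
apply: eq_bigr => i _; congr (_ * _).
have -> : pd (fun z => lin a (G z)) i y = ((jac G y)^T *m a) i 0; last by [].
rewrite pd_comp // mxE; apply: eq_bigr => k _.
by rewrite pd_lin !mxE mulrC.
Qed.

(** Turns the statement on gradients, which concerns the inverse metric, into one on the pulled-back
    metric. *)
Lemma metric_conformal y : exists2 l, 0 < l &
  (jac G y)^T *m etam R n *m jac G y = l *: etam R n.
Proof.
have [l hl] := gradient_conformal y.
have JE := mulmx1C (jac_FG y); have h := similarity_tr JE hl.
by exists l => //; apply: similarity_gt0 n1 JE h.
Qed.

(** [m] is the metric pulled back by [G], [l] its conformal factor, and [Gam] the Christoffel
    symbols: second derivatives of [G] paired with first ones. Once [Gam] vanishes, invertibility of
    the Jacobian kills the second derivatives. *)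
Lemma second_derivative_zero i j k y : pd (pd (fun z => G z k) i) j y = 0.
Proof.
pose H a b c := pd (pd (fun z => G z c) a) b y.
pose m a b z := \sum_k eta R k * (pd (fun z => G z k) a z * pd (fun z => G z k) b z).
have mE a b z : m a b z = ((jac G z)^T *m etam R n *m jac G z) a b.
  by rewrite !mxE; apply: eq_bigr => c _; rewrite mul_mx_diag !mxE; ring.
(* [metric_conformal] gives a factor at each point separately; reading it off the time entry shows
   that it is smooth. *)
pose l z := - m ord_max ord_max z.
have ml a b : m a b = fun z => etam R n a b * l z.
  apply: functional_extensionality => z; rewrite /l !mE.
  have [l' _ ->] := metric_conformal z.
  have sc (S : 'M[R]_n.+1) i' j' : (l' *: S) i' j' = l' * S i' j' by rewrite mxE.
  by rewrite !sc [etam R n ord_max ord_max]etamE eqxx eta_max mulr1n; ring.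
have sp a c : smooth (pd (fun z => G z c) a) by apply: smooth_pd; apply: sG.
have sm a b : smooth (m a b).
  by apply: smooth_sum => c; apply: smooth_scale; apply: smooth_mul.
have sl : smooth l.
  have -> : l = fun z => -1 * m ord_max ord_max z.
    by apply: functional_extensionality => z; rewrite mulN1r.
  exact: smooth_scale.
pose Gam a b c := \sum_k eta R k * (H a b k * pd (fun z => G z k) c y).
have Gam0 : forall a b c, Gam a b c = 0.
  apply: (@conformal_harmonic_vanish _ _ Gam (fun c => pd l c y)) => //.
  - move=> a b c; apply: eq_bigr => d _; rewrite /H pdC //; exact: sG.
  - move=> a b c; rewrite -pd_scale // -ml.
    rewrite pd_sum; last by move=> d; apply: smooth_scale; apply: smooth_mul.
    rewrite -big_split; apply: eq_bigr => d _ /=.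
    rewrite pd_scale; last exact: smooth_mul.
    by rewrite pd_mul // /H; ring.
  - move=> c; under eq_bigr do rewrite mulr_sumr.
    rewrite exchange_big big1 //= => d _.
    transitivity (eta R d * pd (fun z => G z d) c y * box (fun z => G z d) y).
      by rewrite /box mulr_sumr; apply: eq_bigr => a _; rewrite /H; ring.
    by rewrite harmonic_components mulr0.
(* The vanishing of [Gam i j] in matrix form, from which the invertible factors are then removed. *)
have : (\row_c H i j c) *m etam R n *m jac G y = 0.
  apply/rowP => c; rewrite [RHS]mxE -[RHS](Gam0 i j c) mxE; apply: eq_bigr => d _.
  by rewrite mul_mx_diag !mxE; ring.
move/(congr1 (mulmx^~ (jac F (G y) *m etam R n))).
rewrite mul0mx mulmxA -(mulmxA _ (jac G y)) (mulmx1C (jac_FG y)) mulmx1.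
rewrite -mulmxA etamK mulmx1 => /rowP /(_ k); by rewrite !mxE.
Qed.

(** With vanishing second derivatives [G] is affine, and its linear part is a similarity. The
    inverse [A] is a Jacobian of [F], so the sign condition makes it preserve the cone. *)
Lemma wave_preserving_cone p q : cone (vec q - vec p) = cone (vec (F q) - vec (F p)).
Proof.
have JG y z : jac G y = jac G z.
  apply/matrixP => i j; rewrite !mxE.
  have D k x : Defs.is_partial n (pd (fun z => G z i) j) k x 0.
    by have := smooth_partial k x (smooth_pd j (sG i)); rewrite second_derivative_zero.
  rewrite (constant_partials_affine z y D) big1 ?RealsE ?addr0 // => k _.
  by rewrite mul0r.
pose y := F p; pose B := jac G y; pose A := jac F (G y).
have AB : A *m B = 1%:M by apply: jac_FG.
have BA := mulmx1C AB.
have [l l0 hB] := metric_conformal y.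
have [_ hA] := similarity_inv BA hB.
have aff := @jac_const_affine n G B sG (fun z => JG z y) (F p) (F q).
rewrite !FK in aff; rewrite aff.
have li : 0 < l^-1 by rewrite invr_gt0.
by rewrite -(cone_similarity AB hA li (time_ge0 _)) mulmxA AB mul1mx.
Qed.

End WavePreserving.

Open Scope R_scope.

Theorem theorem2p3 (n : nat) (F G : Pt n -> Pt n) (hn : (2 <= n)%N)
  (hFG : cancel F G) (hGF : cancel G F)
  (hF : smooth_map n F) (hG : smooth_map n G) :
  causal_automorphism n F <->
  ((forall x l, is_partial n (fun z => F z ord_max) ord_max x l -> 0 <= l) /\
   (forall phi : Pt n -> R, smooth n phi ->
      (wave_zero n phi <-> wave_zero n (fun y => phi (G y))))).
Proof.
have pdJ x l : is_partial n (fun z => F z ord_max) ord_max x l -> l = jac F x ord_max ord_max.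
  by move=> /is_partial_pd <-; rewrite mxE.
split=> [[_ Fc]|[time wave]].
  split=> [x l /pdJ->|phi sphi].
    by apply/RleP; apply: causal_time_derivative hn hFG hGF hF hG Fc x.
  rewrite (wave_zeroP sphi) (wave_zeroP (smooth_comp sphi hG)).
  have [l l0 bE] := causal_box hn hFG hGF hF hG Fc sphi.
  split=> [h y|h x]; first by rewrite bE h mulr0.
  by have := h (F x); rewrite bE hFG => /eqP; rewrite mulf_eq0 (negPf l0) => /eqP.
have time_ge0 x : (0 <= jac F x ord_max ord_max)%O.
  apply/RleP; apply: (time x); rewrite mxE; exact: smooth_partial.
have wave_comp phi : smooth n phi -> (forall x, box phi x = 0) ->
    forall y, box (fun z => phi (G z)) y = 0.
  move=> sphi /(wave_zeroP sphi) /(wave phi sphi).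
  by move/(wave_zeroP (smooth_comp sphi hG)).
split=> [|p q]; first by exists G.
have E := wave_preserving_cone hn hFG hGF hF hG time_ge0 wave_comp p q.
by split=> /causal_le_cone c; apply/causal_le_cone; rewrite ?E // -E.
Qed.
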